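(* Let $k$ be a field, let $P$ be a poset and let $Q\subseteq P$ be an interior system of $P$. Then the following hold. (1) $\operatorname{Ind}_Q$ sends interval modules to interval modules. In fact, for any interval $S\subseteq Q$ we have $\operatorname{Ind}_Q\mathbb I_S\cong\mathbb I_{\lceil S\rceil_Q}$. (2) If moreover $Q$ is aligned, then $\operatorname{Cont}_Q$ sends interval modules to interval-decomposable modules. In fact, for any interval $T\subseteq P$ we have $\operatorname{Cont}_Q\mathbb I_T\cong\mathbb I_{\overline T^Q}$, where $$\overline T^Q:=\{x\in Q : T\cap\lceil x\rceil_Q \text{ is non-empty and an upset of } \lceil x\rceil_Q\}.$$ Therefore, if $Q$ is an aligned interior system of $P$, then the adjoint pair $\operatorname{Cont}_Q\dashv\operatorname{Ind}_Q$ (with $\operatorname{Cont}_Q\colon\operatorname{Rep}P\to\operatorname{Rep}Q$ left adjoint to $\operatorname{Ind}_Q\colon\operatorname{Rep}Q\to\operatorname{Rep}P$) restricts to an adjoint pair between the full subcategories of interval-decomposable modules.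
   Context: A poset $P$ is regarded as a category with a unique morphism $a\to b$ iff $a\le b$. A $P$-persistence module is a functor from $P$ to $k$-vector spaces (not necessarily finite-dimensional); $\operatorname{Rep}P$ is the category of these. $M|_S$ denotes restriction to a full subposet $S$. A subset $S\subseteq P$ is convex if $x\le z\le y$ with $x,y\in S$, $z\in P$ implies $z\in S$; connected if any two elements of $S$ are joined by a finite sequence of elements of $S$ in which consecutive elements are comparable; an interval if it is convex and connected. A subset $U$ of a poset $R$ is an upset of $R$ if $x\in U$, $y\in R$, $x\le y$ imply $y\in U$. For a convex subset $S\subseteq P$, $\mathbb I_S$ is the module with $\mathbb I_S(x)=k$ for $x\in S$, $0$ otherwise, and $\mathbb I_S(x\le y)=\operatorname{id}_k$ if $x,y\in S$, $0$ otherwise. If $S$ is an interval, $\mathbb I_S$ is an interval module. A module is interval-decomposable if it is isomorphic to a direct sum of interval modules. A full subposet $Q\subseteq P$ is an interior system of $P$ if for every $x\in P$ the maximum $\lfloor x\rfloor_Q:=\max\{y\in Q:y\le x\}$ exists (equivalently the inclusion has a right adjoint). For $S\subseteq Q$ put $\lceil S\rceil_Q=\{a\in P:\lfloor a\rfloor_Q\in S\}$ and $\lceil y\rceil_Q=\{a\in P:\lfloor a\rfloor_Q=y\}$ for $y\in Q$. A poset is filtered if every pair of elements has an upper bound in it. The interior system $Q$ is aligned if $\{a\in P:\lfloor a\rfloor_Q\le y\}$ is filtered for every $y\in Q$. $\operatorname{Ind}_Q\colon\operatorname{Rep}Q\to\operatorname{Rep}P$ is the left Kan extension along the inclusion $Q\hookrightarrow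 P$; for an interior system it is naturally isomorphic to pullback along $\lfloor\ \rfloor_Q$, i.e. $\operatorname{Ind}_QM(a)=M(\lfloor a\rfloor_Q)$. $\operatorname{Cont}_Q\colon\operatorname{Rep}P\to\operatorname{Rep}Q$ is the left Kan extension along $\lfloor\ \rfloor_Q\colon P\to Q$, i.e. $\operatorname{Cont}_QM(x)=\operatorname{colim}\big(M|_{\{a\in P:\lfloor a\rfloor_Q\le x\}}\big)$ with maps induced by the universal property; it is left adjoint to $\operatorname{Ind}_Q$. *)

(* Defs.v *)
From HB Require Import structures.
From mathcomp Require Import all_boot all_order all_algebra.
From mathcomp Require Import finmap all_classical.

Set Implicit Arguments.
Unset Strict Implicit.
Unset Printing Implicit Defensive.

Import Order.TTheory GRing.Theory.
Local Open Scope classical_set_scope.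
Local Open Scope ring_scope.

Record category := Category {
  obj :> Type;
  mor : obj -> obj -> Type;
  idm : forall X, mor X X;
  compm : forall X Y Z, mor Y Z -> mor X Y -> mor X Z;
  comp1m : forall X Y (f : mor X Y), compm (idm Y) f = f;
  compm1 : forall X Y (f : mor X Y), compm f (idm X) = f;
  compmA : forall X Y Z W (h : mor Z W) (g : mor Y Z) (f : mor X Y),
    compm h (compm g f) = compm (compm h g) f }.

Arguments mor {c} X Y.
Arguments idm {c} X.
Arguments compm {c X Y Z} g f.

Record functor (C D : category) := Functor {
  fobj :> C -> D;
  fmap : forall X Y : C, mor X Y -> mor (fobj X) (fobj Y);
  fmap1 : forall X : C, fmap (idm X) = idm (fobj X);
  fmapM : forall (X Y Z : C) (g : mor Y Z) (f : mor X Y),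
    fmap (compm g f) = compm (fmap g) (fmap f) }.

Arguments fmap {C D} f {X Y} g : rename.

Definition isomorphic (C : category) (X Y : C) : Prop :=
  exists (f : mor X Y) (g : mor Y X), compm g f = idm X /\ compm f g = idm Y.

(* [adjunction F G] is the data of F -| G. *)
Record adjunction (C D : category) (F : functor C D) (G : functor D C) :=
  Adjunction {
    adj : forall (X : C) (Y : D), mor (F X) Y -> mor X (G Y);
    adj_bij : forall (X : C) (Y : D), bijective (@adj X Y);
    adj_natl : forall (X X' : C) (Y : D) (u : mor X' X) (f : mor (F X) Y),
      adj (compm f (fmap F u)) = compm (adj f) u;
    adj_natr : forall (X : C) (Y Y' : D) (v : mor Y Y') (f : mor (F X) Y),
      adj (compm v f) = compm (fmap G v) (adj f) }.

Arguments adj {C D F G} a {X Y} f : rename.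

Section FullSubcategory.
Variables (C : category) (A : C -> Prop).

Definition full_subcategory : category :=
  @Category {X : C | A X} (fun X Y => mor (sval X) (sval Y))
    (fun X => idm (sval X)) (fun X Y Z g f => compm g f)
    (fun X Y f => comp1m f) (fun X Y f => compm1 f)
    (fun X Y Z W h g f => compmA h g f).

End FullSubcategory.

Section RestrictFunctor.
Variables (C D : category) (A : C -> Prop) (B : D -> Prop) (F : functor C D).
Hypothesis FAB : forall X, A X -> B (F X).

Definition restrict_functor :
    functor (full_subcategory A) (full_subcategory B) :=
  @Functor (full_subcategory A) (full_subcategory B)
    (fun X => exist B (F (sval X)) (FAB (svalP X)))
    (fun X Y f => fmap F f)
    (fun X => fmap1 F (sval X)) (fun X Y Z g f => fmapM F g f).

End RestrictFunctor.

Section Linear.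
Variable k : fieldType.

Definition mk_linear (U V : lmodType k) (f : U -> V) (fL : linear f) :
    {linear U -> V} :=
  HB.pack f (GRing.isLinear.Build k U V *:%R f fL).

Lemma linear_ext (U V : lmodType k) (f g : {linear U -> V}) :
  f =1 g -> f = g.
Proof.
case: f g => f [[f1] [f2]] [g [[g1] [g2]]] /= /funext fg.
by subst g; congr GRing.Linear.Pack; congr GRing.Linear.Class;
  [congr Algebra.isNmodMorphism.Axioms_ | congr GRing.isScalable.Axioms_];
  apply: Prop_irrelevance.
Qed.

End Linear.

Section DirectSum.
Variables (k : fieldType) (I : choiceType) (V : I -> lmodType k).

Definition dprod := forall i, V i.

HB.instance Definition _ := gen_eqMixin dprod.
HB.instance Definition _ := gen_choiceMixin dprod.

Definition dprod_add (x y : dprod) : dprod := fun i => x i + y i.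
Definition dprod_opp (x : dprod) : dprod := fun i => - x i.
Definition dprod_zero : dprod := fun i => 0.
Definition dprod_scale (c : k) (x : dprod) : dprod := fun i => c *: x i.

Lemma dprod_addA : associative dprod_add.
Proof.
by move=> x y z; apply: functional_extensionality_dep => i; exact: addrA.
Qed.
Lemma dprod_addC : commutative dprod_add.
Proof.
by move=> x y; apply: functional_extensionality_dep => i; exact: addrC.
Qed.
Lemma dprod_add0 : left_id dprod_zero dprod_add.
Proof.
by move=> x; apply: functional_extensionality_dep => i; exact: add0r.
Qed.
Lemma dprod_addN : left_inverse dprod_zero dprod_opp dprod_add.
Proof.
by move=> x; apply: functional_extensionality_dep => i; exact: addNr.
Qed.

HB.instance Definition _ :=
  GRing.isZmodule.Build dprod dprod_addA dprod_addC dprod_add0 dprod_addN.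

Lemma dprod_scaleA a b x :
  dprod_scale a (dprod_scale b x) = dprod_scale (a * b) x.
Proof. by apply: functional_extensionality_dep => i; exact: scalerA. Qed.
Lemma dprod_scale1 : left_id 1 dprod_scale.
Proof.
by move=> x; apply: functional_extensionality_dep => i; exact: scale1r.
Qed.
Lemma dprod_scaleDr : right_distributive dprod_scale +%R.
Proof.
by move=> a x y; apply: functional_extensionality_dep => i; exact: scalerDr.
Qed.
Lemma dprod_scaleDl x : {morph dprod_scale^~ x : a b / a + b}.
Proof.
by move=> a b; apply: functional_extensionality_dep => i; exact: scalerDl.
Qed.

HB.instance Definition _ := GRing.Zmodule_isLmodule.Build k dprod
  dprod_scaleA dprod_scale1 dprod_scaleDr dprod_scaleDl.

Definition has_finsupp : {pred dprod} :=
  fun x => `[< finite_set [set i | x i <> 0] >].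

Lemma has_finsuppP (x : dprod) :
  reflect (finite_set [set i | x i <> 0]) (x \in has_finsupp).
Proof. exact: asboolP. Qed.

Lemma has_finsupp_submod : submod_closed has_finsupp.
Proof.
split=> [|a x y /has_finsuppP fx /has_finsuppP fy]; apply/has_finsuppP.
  by apply: (sub_finite_set _ (finite_set0 I)) => i /=.
apply: (sub_finite_set (B := [set i | x i <> 0] `|` [set i | y i <> 0])).
  move=> i /= xy; have [x0|/eqP ?] := eqVneq (x i) 0; last by left.
  right=> y0; apply: xy.
  by rewrite [LHS](_ : _ = a *: x i + y i)// x0 y0 scaler0 addr0.
by rewrite finite_setU.
Qed.

HB.instance Definition _ :=
  GRing.isSubmodClosed.Build k dprod has_finsupp has_finsupp_submod.

Record dsum := Dsum { dsum_val :> dprod; _ : dsum_val \in has_finsupp }.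

HB.instance Definition _ := [isSub for dsum_val].
HB.instance Definition _ := [Choice of dsum by <:].
HB.instance Definition _ := [SubChoice_isSubLmodule of dsum by <:].

End DirectSum.

Identity Coercion fun_of_dprod : dprod >-> Funclass.

Section DirectSumTheory.
Variables (k : fieldType) (I : choiceType) (V : I -> lmodType k).
Implicit Types x y : dsum V.

Lemma dsumP x y : (forall i, x i = y i) -> x = y.
Proof. by move=> xy; apply: val_inj; apply: functional_extensionality_dep. Qed.

Lemma dsum_fin x : finite_set [set i | x i <> 0].
Proof. by apply/has_finsuppP; exact: valP. Qed.

Lemma dsumDE x y i : (x + y) i = x i + y i. Proof. by []. Qed.
Lemma dsumZE c x i : (c *: x) i = c *: x i. Proof. by []. Qed.
Lemma dsum0E i : (0 : dsum V) i = 0. Proof. by []. Qed.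

Lemma dsum_inj_subproof i (v : V i) :
  (eqtype.dfwith (fun=> 0) v : dprod V) \in @has_finsupp k I V.
Proof.
apply/has_finsuppP; apply: (sub_finite_set _ (finite_set1 i)) => j /=.
by have [->|ij] := eqVneq j i; [|rewrite dfwith_out// eq_sym].
Qed.

Definition dsum_inj_fun i (v : V i) : dsum V := Dsum (dsum_inj_subproof v).

Lemma dsum_inj_linear i : linear (@dsum_inj_fun i).
Proof.
move=> a u v; apply: dsumP => j; rewrite dsumDE dsumZE /=.
have [<-|ij] := eqVneq i j; first by rewrite !dfwith_in.
by rewrite !dfwith_out// scaler0 addr0.
Qed.

Definition dsum_inj i : {linear V i -> dsum V} :=
  mk_linear (@dsum_inj_linear i).

Lemma dsum_injE i (v : V i) : dsum_inj i v i = v.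
Proof. exact: dfwith_in. Qed.

Lemma dsum_injNE i j (v : V i) : i != j -> dsum_inj i v j = 0.
Proof. exact: dfwith_out. Qed.

Section Desc.
Variables (W : lmodType k) (f : forall i, {linear V i -> W}).

Definition dsum_desc_fun (x : dsum V) : W := \sum_(i \in setT) f i (x i).

Lemma dsum_desc_funE x (D : set I) : finite_set D ->
  [set i | x i <> 0] `<=` D -> dsum_desc_fun x = \sum_(i \in D) f i (x i).
Proof.
move=> Dfin xD; apply/esym/fsbig_widen => // i [_ /= nDi].
by rewrite (contra_notP (xD i) nDi) linear0.
Qed.

Lemma dsum_desc_linear : linear dsum_desc_fun.
Proof.
move=> a x y.
set D := [set i | x i <> 0] `|` [set i | y i <> 0].
have Dfin : finite_set D by rewrite finite_setU; split; exact: dsum_fin.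
rewrite !(@dsum_desc_funE _ D)//; last 3 first.
- by move=> i yi; right.
- by move=> i xi; left.
- move=> i /= xyi; have [xi|/eqP ?] := eqVneq (x i) 0; last by left.
  right=> yi; apply: xyi.
  by rewrite -[LHS]/(a *: x i + y i) xi yi scaler0 addr0.
rewrite !fsbig_finite// scaler_sumr -big_split /=.
by apply: eq_bigr => i _; exact: linearP.
Qed.

Definition dsum_desc : {linear dsum V -> W} := mk_linear dsum_desc_linear.

Lemma dsum_desc_inj i v : dsum_desc (dsum_inj i v) = f i v.
Proof.
rewrite /= (@dsum_desc_funE _ [set i])//; last first.
  by move=> j /=; have [//|ij] := eqVneq j i; rewrite dfwith_out// eq_sym.
by rewrite fsbig_set1/= dfwith_in.
Qed.

End Desc.

Lemma dsum_sumE x :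
  x = \sum_(i <- fset_set [set i | x i <> 0]) dsum_inj i (x i).
Proof.
apply: dsumP => j.
have -> : forall (s : seq I),
    (\sum_(i <- s) dsum_inj i (x i)) j = \sum_(i <- s) dsum_inj i (x i) j.
  by elim=> [|i s IH]; rewrite ?big_nil// !big_cons dsumDE IH.
have [xj|/eqP xj] := eqVneq (x j) 0.
  rewrite xj big1_seq// => i _; have [->|ij] := eqVneq i j.
    by rewrite dsum_injE.
  by rewrite dsum_injNE.
rewrite (bigD1_seq j) ?fset_uniq//; last first.
  by rewrite in_fset_set ?inE//; exact: dsum_fin.
rewrite dsum_injE big1 => [|i ij]; first exact/esym/addr0.
by rewrite dsum_injNE// eq_sym.
Qed.

Lemma dsum_ext (W : lmodType k) (g h : {linear dsum V -> W}) :
  (forall i v, g (dsum_inj i v) = h (dsum_inj i v)) -> g = h.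
Proof.
move=> gh; apply: linear_ext => x; rewrite (dsum_sumE x) !linear_sum.
by apply: eq_bigr => i _; exact: gh.
Qed.

End DirectSumTheory.

Arguments dsum_inj {k I V} i.

Section DirectSumMap.
Variables (k : fieldType) (I : choiceType) (V W : I -> lmodType k).
Variable f : forall i, {linear V i -> W i}.

Lemma dsum_map_subproof (x : dsum V) :
  ((fun i => f i (x i)) : dprod W) \in @has_finsupp k I W.
Proof.
apply/has_finsuppP; apply: (sub_finite_set _ (dsum_fin x)) => i /= fx xi.
by apply: fx; rewrite xi linear0.
Qed.

Definition dsum_map_fun (x : dsum V) : dsum W := Dsum (dsum_map_subproof x).

Lemma dsum_map_linear : linear dsum_map_fun.
Proof.
by move=> a x y; apply: dsumP => i; rewrite dsumDE dsumZE /= linearP.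
Qed.

Definition dsum_map : {linear dsum V -> dsum W} := mk_linear dsum_map_linear.

Lemma dsum_mapE x i : dsum_map x i = f i (x i). Proof. by []. Qed.

End DirectSumMap.

(* [quotient_space R] is V modulo the linear span of R; no closure hypothesis on
   R is needed. *)
Section QuotientSpace.
Variables (k : fieldType) (V : lmodType k) (R : set V).

Definition subspace (S : set V) : Prop :=
  S 0 /\ forall (a : k) (u v : V), S u -> S v -> S (a *: u + v).

Definition gen_subspace : set V := smallest subspace R.

Lemma gen_subspaceP : subspace gen_subspace.
Proof.
split; first by move=> S [[S0 _] _].
move=> a u v Su Sv S SR; apply: SR.1.2; [exact: Su|exact: Sv].
Qed.

Definition in_gen : {pred V} := fun x => x \in gen_subspace.

Lemma in_genP x : reflect (gen_subspace x) (x \in in_gen).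
Proof. exact: asboolP. Qed.

Lemma in_gen_submod : submod_closed in_gen.
Proof.
have [S0 SL] := gen_subspaceP.
split=> [|a u v /in_genP Su /in_genP Sv]; apply/in_genP => //.
exact: SL.
Qed.

HB.instance Definition _ := GRing.isSubmodClosed.Build k V in_gen in_gen_submod.

Definition quotient_space := Quotient.quot in_gen.

HB.instance Definition _ := GRing.Zmodule.on quotient_space.

Local Open Scope quotient_scope.

Definition quot_pi (x : V) : quotient_space := \pi_(Quotient.quot in_gen) x.

Lemma quot_pi_eq x y : quot_pi x = quot_pi y <-> gen_subspace (x - y).
Proof.
split=> [/eqP|/in_genP xy]; last apply/eqP.
  by rewrite -[_ == _]Quotient.idealrBE => /in_genP.
by rewrite -[_ == _]Quotient.idealrBE.
Qed.

Lemma quot_piD : {morph quot_pi : x y / x + y}.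
Proof. exact: Quotient.pi_add. Qed.

Lemma quot_pi_surj (q : quotient_space) : quot_pi (repr q) = q.
Proof. exact: (reprK (q : Quotient.quot in_gen)). Qed.

Definition quot_scale (a : k) (q : quotient_space) : quotient_space :=
  quot_pi (a *: repr q).

Lemma quot_piZ a x : quot_scale a (quot_pi x) = quot_pi (a *: x).
Proof.
apply/quot_pi_eq; rewrite -scalerBr -[_ *: _]addr0.
by apply: gen_subspaceP.2; [apply/quot_pi_eq; exact: quot_pi_surj
                           |exact: gen_subspaceP.1].
Qed.

Lemma quot_scaleA a b q : quot_scale a (quot_scale b q) = quot_scale (a * b) q.
Proof. by rewrite -(quot_pi_surj q) !quot_piZ scalerA. Qed.
Lemma quot_scale1 : left_id 1 quot_scale.
Proof. by move=> q; rewrite -(quot_pi_surj q) quot_piZ scale1r. Qed.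
Lemma quot_scaleDr : right_distributive quot_scale +%R.
Proof.
move=> a p q; rewrite -(quot_pi_surj p) -(quot_pi_surj q).
by rewrite -quot_piD !quot_piZ scalerDr quot_piD.
Qed.
Lemma quot_scaleDl q : {morph quot_scale^~ q : a b / a + b}.
Proof.
by move=> a b /=; rewrite -(quot_pi_surj q) !quot_piZ scalerDl quot_piD.
Qed.

HB.instance Definition _ := GRing.Zmodule_isLmodule.Build k quotient_space
  quot_scaleA quot_scale1 quot_scaleDr quot_scaleDl.

Lemma quot_proj_linear : linear quot_pi.
Proof. by move=> a x y; rewrite quot_piD -quot_piZ. Qed.

Definition quot_proj : {linear V -> quotient_space} :=
  mk_linear quot_proj_linear.

Lemma quot_ext (W : lmodType k) (g h : {linear quotient_space -> W}) :
  (forall x, g (quot_proj x) = h (quot_proj x)) -> g = h.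
Proof. by move=> gh; apply: linear_ext => q; rewrite -(quot_pi_surj q) gh. Qed.

Lemma quot_proj0 x : R x -> quot_proj x = 0.
Proof.
move=> Rx; rewrite -(linear0 quot_proj); apply/quot_pi_eq.
by rewrite subr0; apply: sub_gen_smallest.
Qed.

Section Desc.
Variables (W : lmodType k) (f : {linear V -> W}).
Hypothesis fR : forall x, R x -> f x = 0.

Definition quot_desc_fun (q : quotient_space) : W := f (repr q).

Lemma quot_desc_pi x : quot_desc_fun (quot_pi x) = f x.
Proof.
apply/eqP; rewrite -subr_eq0 -linearB; apply/eqP.
have : gen_subspace (repr (quot_pi x) - x).
  by apply/quot_pi_eq; exact: quot_pi_surj.
move: (_ - _); apply: smallest_sub => //; split=> [|a u v fu fv] /=.
  exact: linear0.
by rewrite linearP fu fv scaler0 addr0.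
Qed.

Lemma quot_desc_linear : linear quot_desc_fun.
Proof.
move=> a p q; rewrite -(quot_pi_surj p) -(quot_pi_surj q).
by rewrite -[_ *: _ + _](linearP quot_proj) !quot_desc_pi linearP.
Qed.

Definition quot_desc : {linear quotient_space -> W} :=
  mk_linear quot_desc_linear.

Lemma quot_desc_proj x : quot_desc (quot_proj x) = f x.
Proof. exact: quot_desc_pi. Qed.

End Desc.

End QuotientSpace.

Section Subposet.
Variables (d : Order.disp_t) (P : porderType d) (A : set P).

Definition subposet : Type := {x : P | x \in A}.

HB.instance Definition _ := SubType.copy subposet {x : P | x \in A}.
HB.instance Definition _ := Choice.copy subposet {x : P | x \in A}.
HB.instance Definition _ := [SubChoice_isSubPOrder of subposet by <: with d].

Definition insubposet (x : P) (Ax : A x) : subposet := exist _ x (mem_set Ax).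

Lemma subposetP (x : subposet) : A (val x).
Proof. exact: set_mem (valP x). Qed.

Definition incl (x : subposet) : P := val x.

Lemma incl_homo : {homo incl : x y / (x <= y)%O}.
Proof. by []. Qed.

HB.instance Definition _ := Order.isOrderMorphism.Build d subposet d P
  incl incl_homo.

End Subposet.

Section WidenSubposet.
Variables (d : Order.disp_t) (P : porderType d) (A B : set P).
Hypothesis AB : A `<=` B.

Definition widen_sub (x : subposet A) : subposet B :=
  insubposet (AB (subposetP x)).

Lemma widen_sub_homo : {homo widen_sub : x y / (x <= y)%O}.
Proof. by []. Qed.

End WidenSubposet.

Section PersistenceModule.
Variables (k : fieldType) (d : Order.disp_t) (P : porderType d).

Record pmod := PMod {
  pmod_obj :> P -> lmodType k;
  pmod_map : forall x y : P, (x <= y)%O -> {linear pmod_obj x -> pmod_obj y};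
  pmod_map1 : forall (x : P) (xx : (x <= x)%O) v, pmod_map xx v = v;
  pmod_mapM : forall (x y z : P) (xy : (x <= y)%O) (yz : (y <= z)%O)
    (xz : (x <= z)%O) v, pmod_map xz v = pmod_map yz (pmod_map xy v) }.

Record pmor (M N : pmod) := PMor {
  pmor_app :> forall x : P, {linear M x -> N x};
  pmor_nat : forall (x y : P) (xy : (x <= y)%O) v,
    pmor_app y (pmod_map M xy v) = pmod_map N xy (pmor_app x v) }.

Lemma pmor_ext (M N : pmod) (f g : pmor M N) :
  (forall x v, f x v = g x v) -> f = g.
Proof.
case: f g => f fN [g gN] /= fg.
have E : f = g.
  apply: functional_extensionality_dep => x; apply: linear_ext => v.
  exact: fg.
by clear fg; subst g; congr PMor; exact: Prop_irrelevance.
Qed.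

Lemma pmor_id_nat (M : pmod) (x y : P) (xy : (x <= y)%O) (v : M x) :
  idfun (pmod_map M xy v) = pmod_map M xy (idfun v).
Proof. by []. Qed.

Definition pmor_id (M : pmod) : pmor M M :=
  @PMor M M (fun x => idfun : {linear M x -> M x}) (@pmor_id_nat M).

Lemma pmor_comp_nat (M N L : pmod) (g : pmor N L) (f : pmor M N)
    (x y : P) (xy : (x <= y)%O) (v : M x) :
  (g y \o f y) (pmod_map M xy v) = pmod_map L xy ((g x \o f x) v).
Proof. by rewrite /= !pmor_nat. Qed.

Definition pmor_comp (M N L : pmod) (g : pmor N L) (f : pmor M N) :
    pmor M L :=
  @PMor M L (fun x => g x \o f x : {linear M x -> L x}) (pmor_comp_nat g f).

Lemma pmor_comp1m (M N : pmod) (f : pmor M N) : pmor_comp (pmor_id N) f = f.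
Proof. exact: pmor_ext. Qed.
Lemma pmor_compm1 (M N : pmod) (f : pmor M N) : pmor_comp f (pmor_id M) = f.
Proof. exact: pmor_ext. Qed.
Lemma pmor_compA (M N L K : pmod) (h : pmor L K) (g : pmor N L)
    (f : pmor M N) :
  pmor_comp h (pmor_comp g f) = pmor_comp (pmor_comp h g) f.
Proof. exact: pmor_ext. Qed.

Definition Rep : category :=
  Category pmor_comp1m pmor_compm1 pmor_compA.

End PersistenceModule.

Section Pullback.
Variables (k : fieldType) (d d' : Order.disp_t).
Variables (R : porderType d') (P : porderType d) (f : {omorphism R -> P}).

Definition pullback (M : pmod k P) : pmod k R :=
  @PMod k d' R (fun x => M (f x))
    (fun x y xy => pmod_map M (Order.OrderMorphismTheory.omorph_le f xy))
    (fun x xx => pmod_map1 _) (fun x y z xy yz xz => pmod_mapM _ _ _).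

Definition pullback_mor (M N : pmod k P) (u : pmor M N) :
    pmor (pullback M) (pullback N) :=
  @PMor k d' R (pullback M) (pullback N) (fun x => u (f x))
    (fun x y xy => pmor_nat u _).

End Pullback.

Definition restriction (k : fieldType) (d : Order.disp_t) (P : porderType d)
  (M : pmod k P) (A : set P) : pmod k (subposet A) := pullback (@incl d P A) M.

Section PmodSum.
Variables (k : fieldType) (d : Order.disp_t) (P : porderType d).
Variables (I : choiceType) (M : I -> pmod k P).

Let sum_obj (x : P) : lmodType k := dsum (fun i => M i x).
Let sum_map (x y : P) (xy : (x <= y)%O) : {linear sum_obj x -> sum_obj y} :=
  dsum_map (fun i => pmod_map (M i) xy).

Lemma pmod_sum_map1 (x : P) (xx : (x <= x)%O) (v : sum_obj x) :
  sum_map xx v = v.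
Proof. by apply: dsumP => i; exact: pmod_map1. Qed.

Lemma pmod_sum_mapM (x y z : P) (xy : (x <= y)%O) (yz : (y <= z)%O)
    (xz : (x <= z)%O) (v : sum_obj x) :
  sum_map xz v = sum_map yz (sum_map xy v).
Proof. by apply: dsumP => i; exact: pmod_mapM. Qed.

Definition pmod_sum : pmod k P := PMod pmod_sum_map1 pmod_sum_mapM.

End PmodSum.

Section Colimit.
Variables (k : fieldType) (d : Order.disp_t) (P : porderType d).
Variable M : pmod k P.

Definition colim_rel : set (dsum M) :=
  [set r : dsum M | exists (x y : P) (xy : (x <= y)%O) (v : M x),
    r = dsum_inj y (pmod_map M xy v) - dsum_inj x v].

Definition colim : lmodType k := quotient_space colim_rel.

Definition colim_inj (x : P) : {linear M x -> colim} :=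
  quot_proj colim_rel \o dsum_inj x.

Lemma colim_injE (x y : P) (xy : (x <= y)%O) (v : M x) :
  colim_inj y (pmod_map M xy v) = colim_inj x v.
Proof.
apply/eqP; rewrite -subr_eq0; apply/eqP.
rewrite -[LHS](linearB (quot_proj colim_rel)).
by apply: quot_proj0; exists x, y, xy, v.
Qed.

Lemma colim_ext (W : lmodType k) (g h : {linear colim -> W}) :
  (forall x v, g (colim_inj x v) = h (colim_inj x v)) -> g = h.
Proof.
move=> gh; apply: quot_ext => s.
suff : (g \o quot_proj colim_rel : {linear _ -> _}) =
       (h \o quot_proj colim_rel : {linear _ -> _}).
  by move=> /(congr1 (fun u : {linear dsum M -> W} => u s)).
exact: dsum_ext.
Qed.

Section Desc.
Variables (W : lmodType k) (f : forall x, {linear M x -> W}).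
Hypothesis fE : forall (x y : P) (xy : (x <= y)%O) (v : M x),
  f y (pmod_map M xy v) = f x v.

Lemma colim_desc_subproof r : colim_rel r -> dsum_desc f r = 0.
Proof.
move=> [x [y [xy [v ->]]]].
by rewrite linearB !dsum_desc_inj fE subrr.
Qed.

Definition colim_desc : {linear colim -> W} := quot_desc colim_desc_subproof.

Lemma colim_desc_inj x v : colim_desc (colim_inj x v) = f x v.
Proof. by rewrite [LHS]quot_desc_proj dsum_desc_inj. Qed.

End Desc.

End Colimit.

Section ColimitMap.
Variables (k : fieldType) (d : Order.disp_t) (P : porderType d).
Variables (M N : pmod k P) (u : pmor M N).

Lemma colim_map_subproof (x y : P) (xy : (x <= y)%O) (v : M x) :
  (colim_inj N y \o u y) (pmod_map M xy v) = (colim_inj N x \o u x) v.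
Proof. by rewrite -[LHS]/(colim_inj N y (u y _)) pmor_nat colim_injE. Qed.

Definition colim_map : {linear colim M -> colim N} :=
  colim_desc colim_map_subproof.

Lemma colim_map_inj x v : colim_map (colim_inj M x v) = colim_inj N x (u x v).
Proof. exact: colim_desc_inj. Qed.

End ColimitMap.

Section ColimitWiden.
Variables (k : fieldType) (d : Order.disp_t) (P : porderType d).
Variables (M : pmod k P) (A B : set P) (AB : A `<=` B).

Lemma colim_widen_subproof (x y : subposet A) (xy : (x <= y)%O)
    (v : restriction M A x) :
  (colim_inj (restriction M B) (widen_sub AB y) :
      {linear restriction M A y -> _}) (pmod_map (restriction M A) xy v) =
  (colim_inj (restriction M B) (widen_sub AB x) :
      {linear restriction M A x -> _}) v.
Proof.
rewrite -[RHS](colim_injE (widen_sub_homo AB xy)); congr (colim_inj _ _ _).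
rewrite /=; congr (pmod_map M _ v); exact: Prop_irrelevance.
Qed.

Definition colim_widen :
    {linear colim (restriction M A) -> colim (restriction M B)} :=
  colim_desc colim_widen_subproof.

Lemma colim_widen_inj (x : subposet A) (v : M (incl x)) :
  colim_widen (colim_inj (restriction M A) x v) =
  colim_inj (restriction M B) (widen_sub AB x) v.
Proof. exact: colim_desc_inj. Qed.

End ColimitWiden.

(* The left Kan extension along a morphism of posets [f], by the pointwise
   colimit formula over the comma posets {a | f a <= x}; [lan_universal] and
   [lan_unit_mor] are its defining universal property. *)
Section LeftKanExtension.
Variables (k : fieldType) (d d' : Order.disp_t).
Variables (P : porderType d) (R : porderType d') (f : {omorphism P -> R}).

Definition comma (x : R) : set P := [set a | (f a <= x)%O].

Lemma comma_sub (x y : R) : (x <= y)%O -> comma x `<=` comma y.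
Proof. by move=> xy a /le_trans; apply. Qed.

Section Object.
Variable M : pmod k P.

Let lan_obj_at (x : R) : lmodType k := colim (restriction M (comma x)).
Let lan_map (x y : R) (xy : (x <= y)%O) :
  {linear lan_obj_at x -> lan_obj_at y} := colim_widen M (comma_sub xy).

Lemma lan_map1 (x : R) (xx : (x <= x)%O) (v : lan_obj_at x) :
  lan_map xx v = v.
Proof.
suff -> : lan_map xx = (idfun : {linear _ -> _}) by [].
apply: colim_ext => a w; rewrite colim_widen_inj -[RHS]/(colim_inj _ a w).
have ab : (a <= widen_sub (comma_sub xx) a)%O := lexx (val a).
rewrite -[RHS](colim_injE ab); congr (colim_inj _ _ _).
exact: (esym (@pmod_map1 k d P M (incl a) _ w)).
Qed.

Lemma lan_mapM (x y z : R) (xy : (x <= y)%O) (yz : (y <= z)%O)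
    (xz : (x <= z)%O) (v : lan_obj_at x) :
  lan_map xz v = lan_map yz (lan_map xy v).
Proof.
suff -> : lan_map xz = (lan_map yz \o lan_map xy : {linear _ -> _}) by [].
apply: colim_ext => a w.
rewrite -[RHS]/(lan_map yz (lan_map xy _)) !colim_widen_inj.
set b := widen_sub _ a; set c := widen_sub _ _.
have bc : (b <= c)%O := lexx (val a).
rewrite -[LHS](colim_injE bc); congr (colim_inj _ _ _).
exact: (@pmod_map1 k d P M (incl a) _ w).
Qed.

Definition lan_obj : pmod k R := PMod lan_map1 lan_mapM.

Lemma lan_obj_mapE (x y : R) (xy : (x <= y)%O) (a : subposet (comma x))
    (w : M (incl a)) :
  pmod_map lan_obj xy (colim_inj (restriction M (comma x)) a w) =
  colim_inj (restriction M (comma y)) (widen_sub (comma_sub xy) a) w.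
Proof. exact: colim_widen_inj. Qed.

End Object.

Section Morphism.
Variables (M N : pmod k P) (u : pmor M N).

Let lan_mor_at (x : R) : {linear lan_obj M x -> lan_obj N x} :=
  colim_map (pullback_mor (@incl d P (comma x)) u).

Lemma lan_mor_nat (x y : R) (xy : (x <= y)%O) (v : lan_obj M x) :
  lan_mor_at y (pmod_map (lan_obj M) xy v) =
  pmod_map (lan_obj N) xy (lan_mor_at x v).
Proof.
suff : (lan_mor_at y \o pmod_map (lan_obj M) xy : {linear _ -> _}) =
       (pmod_map (lan_obj N) xy \o lan_mor_at x : {linear _ -> _}).
  by move=> /(congr1 (fun g : {linear lan_obj M x -> lan_obj N y} => g v)).
apply: colim_ext => a w.
rewrite -[LHS]/(lan_mor_at y (pmod_map _ _ _)).
rewrite -[RHS]/(pmod_map _ _ (lan_mor_at x _)).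
by rewrite lan_obj_mapE !colim_map_inj lan_obj_mapE.
Qed.

Definition lan_mor : pmor (lan_obj M) (lan_obj N) := PMor lan_mor_nat.

Lemma lan_morE (x : R) (a : subposet (comma x)) (w : M (incl a)) :
  lan_mor x (colim_inj (restriction M (comma x)) a w) =
  colim_inj (restriction N (comma x)) a (u (incl a) w).
Proof. exact: colim_map_inj. Qed.

End Morphism.

Lemma lan_obj_ext (M : pmod k P) (L : pmod k R) (g h : pmor (lan_obj M) L) :
  (forall x a w, g x (colim_inj (restriction M (comma x)) a w) =
                 h x (colim_inj (restriction M (comma x)) a w)) -> g = h.
Proof.
move=> gh; apply: pmor_ext => x v; suff -> : g x = h x by [].
by apply: colim_ext => a w; exact: gh.
Qed.

Lemma lan_mor1 (M : pmod k P) : lan_mor (pmor_id M) = pmor_id (lan_obj M).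
Proof. by apply: lan_obj_ext => x a w; rewrite lan_morE. Qed.

Lemma lan_morM (M N L : pmod k P) (g : pmor N L) (h : pmor M N) :
  lan_mor (pmor_comp g h) = pmor_comp (lan_mor g) (lan_mor h).
Proof.
apply: lan_obj_ext => x a w.
by rewrite -[RHS]/(lan_mor g x (lan_mor h x _)) !lan_morE.
Qed.

Definition lan : functor (Rep k P) (Rep k R) :=
  @Functor (Rep k P) (Rep k R) lan_obj lan_mor lan_mor1 lan_morM.

Section Universal.
Variable M : pmod k P.

Let self (a : P) : subposet (comma (f a)) :=
  @insubposet d P (comma (f a)) a (lexx (f a)).

Let unit_at (a : P) : {linear M a -> pullback f (lan_obj M) a} :=
  colim_inj (restriction M (comma (f a))) (self a).

Lemma lan_unit_nat (a b : P) (ab : (a <= b)%O) (v : M a) :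
  unit_at b (pmod_map M ab v) =
  pmod_map (pullback f (lan_obj M)) ab (unit_at a v).
Proof.
rewrite [RHS]lan_obj_mapE.
set a' := widen_sub _ (self a).
have a'b : (a' <= self b)%O := ab.
rewrite -[RHS](colim_injE a'b); congr (colim_inj _ _ _).
by congr (pmod_map M _ v); exact: Prop_irrelevance.
Qed.

Definition lan_unit : pmor M (pullback f (lan_obj M)) := PMor lan_unit_nat.

Lemma lan_obj_gen (x : R) (a : subposet (comma x)) (w : M (incl a)) :
  colim_inj (restriction M (comma x)) a w =
  pmod_map (lan_obj M) (subposetP a) (lan_unit (incl a) w).
Proof.
rewrite [RHS]lan_obj_mapE; set b := widen_sub _ _.
have ab : (a <= b)%O := lexx (val a).
rewrite -[LHS](colim_injE ab); congr (colim_inj _ _ _).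
exact: (@pmod_map1 k d P M (incl a) _ w).
Qed.

Section Desc.
Variables (N : pmod k R) (g : pmor M (pullback f N)).

Let desc_leg (x : R) (a : subposet (comma x)) :
    {linear restriction M (comma x) a -> N x} :=
  pmod_map N (subposetP a : (f (incl a) <= x)%O) \o g (incl a).

Lemma lan_desc_leg (x : R) (a b : subposet (comma x)) (ab : (a <= b)%O) v :
  desc_leg b (pmod_map (restriction M (comma x)) ab v) = desc_leg a v.
Proof.
rewrite -[LHS]/(pmod_map N _ (g _ (pmod_map M _ _))) pmor_nat.
exact: (esym (@pmod_mapM k d' R N _ _ _ _ _ _ _)).
Qed.

Let desc_at (x : R) : {linear lan_obj M x -> N x} :=
  colim_desc (@lan_desc_leg x).

Lemma lan_desc_nat (x y : R) (xy : (x <= y)%O) v :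
  desc_at y (pmod_map (lan_obj M) xy v) = pmod_map N xy (desc_at x v).
Proof.
suff : (desc_at y \o pmod_map (lan_obj M) xy : {linear _ -> _}) =
       (pmod_map N xy \o desc_at x : {linear _ -> _}).
  by move=> /(congr1 (fun h : {linear lan_obj M x -> N y} => h v)).
apply: colim_ext => a w.
rewrite -[LHS]/(desc_at y (pmod_map _ _ _)).
rewrite -[RHS]/(pmod_map _ _ (desc_at x _)).
rewrite lan_obj_mapE !colim_desc_inj.
exact: (@pmod_mapM k d' R N _ _ _ _ _ _ _).
Qed.

Definition lan_desc : pmor (lan_obj M) N := PMor lan_desc_nat.

Lemma lan_descE (a : P) (v : M a) : lan_desc (f a) (lan_unit a v) = g a v.
Proof. by rewrite [LHS]colim_desc_inj; exact: pmod_map1. Qed.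

End Desc.

Lemma lan_universal (N : pmod k R) (g : pmor M (pullback f N)) :
  exists! h : pmor (lan_obj M) N, pmor_comp (pullback_mor f h) lan_unit = g.
Proof.
exists (lan_desc g); split; first by apply: pmor_ext => a v; exact: lan_descE.
move=> h <-; apply: lan_obj_ext => x a w.
by rewrite lan_obj_gen !pmor_nat lan_descE.
Qed.

End Universal.

Lemma lan_unit_mor (M N : pmod k P) (u : pmor M N) :
  pmor_comp (pullback_mor f (lan_mor u)) (lan_unit M) =
  pmor_comp (lan_unit N) u.
Proof. by apply: pmor_ext => a v; exact: lan_morE. Qed.

End LeftKanExtension.

Section Intervals.
Variables (d : Order.disp_t) (P : porderType d).
Implicit Types S U R : set P.

Definition poset_convex S : Prop :=
  forall x y z : P, S x -> S y -> (x <= z)%O -> (z <= y)%O -> S z.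

Definition poset_connected S : Prop :=
  forall x y : P, S x -> S y -> exists s : seq P,
    [/\ path (fun a b => (a >=< b)%O) x s, last x s = y &
        forall z, z \in s -> S z].

(* The empty set is an interval; its indicator module is zero. *)
Definition poset_interval S : Prop := poset_convex S /\ poset_connected S.

Definition upset_of R U : Prop :=
  U `<=` R /\ forall x y : P, U x -> R y -> (x <= y)%O -> U y.

Definition filtered S : Prop :=
  forall x y : P, S x -> S y -> exists z, [/\ S z, (x <= z)%O & (y <= z)%O].

End Intervals.

Section IndicatorSpace.
Variable k : fieldType.

Definition ind_space (b : bool) : lmodType k :=
  if b then (k^o : lmodType k) else ('rV[k]_0 : lmodType k).

Definition ind_map (b c : bool) : {linear ind_space b -> ind_space c} :=
  match b, c return {linear ind_space b -> ind_space c} with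
  | true, true => idfun
  | _, _ => \0
  end.

Lemma ind_space0 (v : ind_space false) : v = 0.
Proof. exact: thinmx0. Qed.

Lemma ind_map1 (b : bool) (v : ind_space b) : ind_map b b v = v.
Proof. by case: b v => // v; rewrite [RHS]ind_space0. Qed.

Lemma ind_mapM (a b c : bool) (v : ind_space a) :
  (a && c ==> b) -> ind_map a c v = ind_map b c (ind_map a b v).
Proof.
by case: a b c v => [] [] [] v //= _; rewrite ?[LHS]ind_space0 ?linear0.
Qed.

End IndicatorSpace.

Section IndicatorModule.
Variables (k : fieldType) (d : Order.disp_t) (P : porderType d) (S : set P).
Hypothesis convS : poset_convex S.

Let obj_at (x : P) : lmodType k := ind_space k (x \in S).
Let map_at (x y : P) (xy : (x <= y)%O) : {linear obj_at x -> obj_at y} :=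
  ind_map k (x \in S) (y \in S).

Lemma indicator_map1 (x : P) (xx : (x <= x)%O) (v : obj_at x) :
  map_at xx v = v.
Proof. exact: ind_map1. Qed.

Lemma indicator_mapM (x y z : P) (xy : (x <= y)%O) (yz : (y <= z)%O)
    (xz : (x <= z)%O) (v : obj_at x) :
  map_at xz v = map_at yz (map_at xy v).
Proof.
apply: ind_mapM; apply/implyP => /andP[/set_mem Sx /set_mem Sz].
by apply/mem_set; exact: convS Sx Sz xy yz.
Qed.

Definition indicator : pmod k P := PMod indicator_map1 indicator_mapM.

End IndicatorModule.

Arguments indicator k {d P S} convS.

Section IntervalModules.
Variables (k : fieldType) (d : Order.disp_t) (P : porderType d).

Definition interval_module (M : Rep k P) : Prop :=
  exists (S : set P) (intS : poset_interval S),
    @isomorphic (Rep k P) M (indicator k (proj1 intS)).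

Definition interval_decomposable (M : Rep k P) : Prop :=
  exists (I : choiceType) (N : I -> pmod k P),
    (forall i, interval_module (N i)) /\
    @isomorphic (Rep k P) M (pmod_sum N).

End IntervalModules.

Section InteriorSystem.
Variables (d : Order.disp_t) (P : porderType d) (Q : set P).

(* y is the maximum of {z in Q | z <= x}. *)
Definition is_floor (x y : P) : Prop :=
  [/\ Q y, (y <= x)%O & forall z, Q z -> (z <= x)%O -> (z <= y)%O].

Definition interior_system : Prop := forall x : P, exists y, is_floor x y.

Hypothesis intQ : interior_system.

Lemma qfloor_subproof (x : P) : Q (sval (cid (intQ x))).
Proof. by case: (svalP (cid (intQ x))). Qed.

Definition qfloor (x : P) : subposet Q := insubposet (qfloor_subproof x).

Lemma qfloorP (x : P) : is_floor x (incl (qfloor x)).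
Proof. exact: svalP (cid (intQ x)). Qed.

Lemma qfloor_homo : {homo qfloor : x y / (x <= y)%O}.
Proof.
move=> x y xy; have [Qx xlx _] := qfloorP x; have [_ _] := qfloorP y.
by apply=> //; exact: le_trans xy.
Qed.

HB.instance Definition _ := Order.isOrderMorphism.Build d P d (subposet Q)
  qfloor qfloor_homo.

(* [qceil], [qfiber] and [qclosure] are, for S a subset of Q, y in Q and T a
   subset of P, the sets written $\lceil S\rceil_Q$, $\lceil y\rceil_Q$ and
   $\overline{T}^Q$. *)
Definition qceil (S : set (subposet Q)) : set P := [set a | S (qfloor a)].

Definition qfiber (y : subposet Q) : set P := [set a | qfloor a = y].

Definition aligned : Prop :=
  forall y : subposet Q, filtered [set a | (qfloor a <= y)%O].

Definition qclosure (T : set P) : set (subposet Q) :=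
  [set x | (T `&` qfiber x) !=set0 /\
           upset_of (qfiber x) (T `&` qfiber x)].

End InteriorSystem.

Section IndCont.
Variables (k : fieldType) (d : Order.disp_t) (P : porderType d) (Q : set P).

Definition Ind : functor (Rep k (subposet Q)) (Rep k P) := lan k (@incl d P Q).

Definition Cont (intQ : interior_system Q) :
    functor (Rep k P) (Rep k (subposet Q)) := lan k (qfloor intQ).

End IndCont.

(* Main.v *)
Require Import Defs.
From mathcomp Require Import all_boot all_order all_algebra.
From mathcomp Require Import finmap all_classical.
(* [incl] and [fmap] name the inclusion of a subposet and the action of a functor
   on morphisms, not the homonymous operations on finite sets. *)
Import Defs.

Set Implicit Arguments.
Unset Strict Implicit.
Unset Printing Implicit Defensive.

Import Order.TTheory GRing.Theory.
Local Open Scope classical_set_scope.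
Local Open Scope ring_scope.

(** The isomorphisms are all obtained from explicit morphisms.

    [Ind]. Below a given [a] in [P], the subposet [Q] has a largest element, the
    floor of [a], so the colimit computing the left Kan extension at [a] is the
    value at the floor: [Ind M] is the pullback of [M] along the floor map
    ([Ind_pullback]). The pullback of an indicator module is the indicator of
    the preimage, and the preimage of an interval under the floor map is an
    interval since every element is comparable to its floor ([qceil_interval]).

    [Cont]. Write [D x] for the set of all [a] whose floor is at most [x]. For
    an aligned system it is filtered, and the fiber of the floor map over [x] is
    a nonempty upset of it, hence cofinal. For a convex [T], this turns membership
    of [x] in the closure of [T] into: some [a] in [D x] has all the elements of
    [D x] above it in [T] ([qclosure_tail]). The colimit over [D x] of the
    indicator of [T] is then the field if [x] is in the closure, and otherwise
    every element of the indicator is sent to zero by going up in [D x]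
    ([Cont_indicator_bij]). The closure is convex but may be disconnected; the
    indicator of a convex set is the direct sum of the indicators of its
    connected components ([indicator_sum_components]), so that [Cont] of an
    interval module is interval-decomposable.

    Both functors are left Kan extensions, and those commute with direct sums
    ([lan_sum]); hence both preserve interval-decomposable modules. The
    transposition of the adjunction is given by the universal property of the
    left Kan extension along the floor map followed by the identification of
    [Ind] with the pullback ([Cont_Ind_adjunction]), and any adjunction
    restricts to full subcategories preserved by both functors. *)

Lemma dfun_choice (I : Type) (T : I -> Type) (R : forall i, T i -> Prop) :
  (forall i, exists x, R i x) -> exists f : forall i, T i, forall i, R i (f i).
Proof.
by move=> RP; exists (fun i => sval (cid (RP i))) => i; exact: svalP.
Qed.

(** * Isomorphisms *)

Section Isomorphisms.
Variable C : category.
Implicit Types X Y Z : C.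

Lemma isomorphic_refl X : isomorphic X X.
Proof. by exists (idm X), (idm X); rewrite comp1m. Qed.

Lemma isomorphic_sym X Y : isomorphic X Y -> isomorphic Y X.
Proof. by move=> [f [g [gf fg]]]; exists g, f. Qed.

Lemma isomorphic_trans Y X Z :
  isomorphic X Y -> isomorphic Y Z -> isomorphic X Z.
Proof.
move=> [f [g [gf fg]]] [f' [g' [gf' fg']]].
exists (compm f' f), (compm g g'); split.
  by rewrite compmA -(compmA g g' f') gf' compm1.
by rewrite compmA -(compmA f' f g) fg compm1.
Qed.

End Isomorphisms.

Lemma functor_isomorphic (C D : category) (F : functor C D) (X Y : C) :
  isomorphic X Y -> isomorphic (F X) (F Y).
Proof.
move=> [f [g [gf fg]]]; exists (fmap F f), (fmap F g).
by rewrite -!fmapM gf fg !fmap1.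
Qed.

Section PersistenceIsomorphisms.
Variables (k : fieldType) (d : Order.disp_t) (P : porderType d).

Lemma pmor_bij_isomorphic (M N : pmod k P) (f : pmor M N) :
  (forall x, bijective (f x)) -> @isomorphic (Rep k P) M N.
Proof.
move=> fbij.
have gP x : exists g : {linear N x -> M x}, cancel (f x) g /\ cancel g (f x).
  have [g fK gK] := fbij x; have gL : linear g.
    by move=> a u v; apply: (can_inj fK); rewrite linearP !gK.
  by exists (mk_linear gL).
have [g fgK] := dfun_choice gP.
have fK x := (fgK x).1; have gK x := (fgK x).2.
have gnat (x y : P) (xy : (x <= y)%O) v :
    g y (pmod_map N xy v) = pmod_map M xy (g x v).
  by apply: (can_inj (fK y)); rewrite gK pmor_nat gK.
exists f, (PMor gnat); split; apply: pmor_ext => x v; first exact: fK.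
exact: gK.
Qed.

End PersistenceIsomorphisms.

(** * Direct sums of persistence modules *)

Section Coproducts.
Variables (k : fieldType) (d : Order.disp_t) (P : porderType d).
Variables (I : choiceType) (M : I -> pmod k P).

Lemma pmod_inj_nat i (x y : P) (xy : (x <= y)%O) (v : M i x) :
  dsum_inj i (pmod_map (M i) xy v) =
  pmod_map (pmod_sum M) xy (dsum_inj (V := fun j => M j x) i v)
  :> pmod_sum M y.
Proof.
apply: dsumP => j; rewrite [RHS]dsum_mapE; have [<-|ij] := eqVneq i j.
  by rewrite !dsum_injE.
by rewrite !dsum_injNE// linear0.
Qed.

(** The canonical injection of a summand. *)
Definition pmod_inj i : pmor (M i) (pmod_sum M) :=
  @PMor k d P (M i) (pmod_sum M)
    (fun x => dsum_inj (V := fun j => M j x) i) (@pmod_inj_nat i).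

Lemma pmod_sum_ext (N : pmod k P) (g h : pmor (pmod_sum M) N) :
  (forall i, pmor_comp g (pmod_inj i) = pmor_comp h (pmod_inj i)) -> g = h.
Proof.
move=> gh; apply: pmor_ext => x v; suff -> : g x = h x by [].
by apply: dsum_ext => i w; exact: (congr1 (fun u : pmor _ _ => u x w) (gh i)).
Qed.

Section Desc.
Variables (N : pmod k P) (f : forall i, pmor (M i) N).

Lemma pmod_desc_nat (x y : P) (xy : (x <= y)%O) (v : pmod_sum M x) :
  dsum_desc (fun i => f i y) (pmod_map (pmod_sum M) xy v) =
  pmod_map N xy (dsum_desc (fun i => f i x) v).
Proof.
suff : (dsum_desc (fun i => f i y) \o pmod_map (pmod_sum M) xy
          : {linear _ -> _}) =
       (pmod_map N xy \o dsum_desc (fun i => f i x) : {linear _ -> _}).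
  by move=> /(congr1 (fun g : {linear pmod_sum M x -> N y} => g v)).
apply: dsum_ext => i w.
rewrite -[LHS]/(dsum_desc (fun i => f i y)
  (pmod_map (pmod_sum M) xy (dsum_inj (V := fun i => M i x) i w))).
rewrite -[RHS]/(pmod_map N xy
  (dsum_desc (fun i => f i x) (dsum_inj (V := fun i => M i x) i w))).
by rewrite -pmod_inj_nat !dsum_desc_inj pmor_nat.
Qed.

(** The morphism out of a direct sum given by a family of morphisms out of the
    summands. *)
Definition pmod_desc : pmor (pmod_sum M) N := PMor pmod_desc_nat.

Lemma pmod_desc_inj i : pmor_comp pmod_desc (pmod_inj i) = f i.
Proof. by apply: pmor_ext => x v; exact: dsum_desc_inj. Qed.

End Desc.

End Coproducts.

Section CoproductIsomorphisms.
Variables (k : fieldType) (d : Order.disp_t) (P : porderType d).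

Lemma pmod_sum_isomorphic (I : choiceType) (M N : I -> pmod k P) :
  (forall i, @isomorphic (Rep k P) (M i) (N i)) ->
  @isomorphic (Rep k P) (pmod_sum M) (pmod_sum N).
Proof.
move=> MN; have [f fP] := dfun_choice MN; have [g fg] := dfun_choice fP.
exists (pmod_desc (fun i => pmor_comp (pmod_inj N i) (f i))).
exists (pmod_desc (fun i => pmor_comp (pmod_inj M i) (g i))).
split; apply: pmod_sum_ext => i; rewrite /= -pmor_compA pmod_desc_inj.
  rewrite pmor_compA pmod_desc_inj -pmor_compA.
  by have /= [-> _] := fg i; rewrite pmor_comp1m pmor_compm1.
rewrite pmor_compA pmod_desc_inj -pmor_compA.
by have /= [_ ->] := fg i; rewrite pmor_comp1m pmor_compm1.
Qed.

Lemma pmod_sum_sum (I : choiceType) (J : I -> choiceType)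
    (M : forall i, J i -> pmod k P) :
  @isomorphic (Rep k P) (pmod_sum (fun i => pmod_sum (M i)))
    (pmod_sum (fun ij : {i : I & J i} => M (tag ij) (tagged ij))).
Proof.
set N := fun ij : {i : I & J i} => M (tag ij) (tagged ij).
exists (pmod_desc (fun i => pmod_desc (fun j => pmod_inj N (Tagged J j)))).
exists (pmod_desc (fun ij : {i : I & J i} =>
  pmor_comp (pmod_inj (fun i => pmod_sum (M i)) (tag ij))
    (pmod_inj (M (tag ij)) (tagged ij)))).
split.
  apply: pmod_sum_ext => i; apply: pmod_sum_ext => j.
  rewrite /= pmor_comp1m -!pmor_compA (pmor_compA _ (pmod_inj _ i)).
  by rewrite pmod_desc_inj pmod_desc_inj (pmod_desc_inj _ (Tagged J j)).
apply: pmod_sum_ext => -[i j].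
rewrite /= pmor_comp1m -pmor_compA pmod_desc_inj pmor_compA pmod_desc_inj.
exact: (pmod_desc_inj (fun j => pmod_inj N (Tagged J j)) j).
Qed.

Lemma interval_decomposable_iso (M N : Rep k P) :
  isomorphic M N -> interval_decomposable N -> interval_decomposable M.
Proof.
move=> MN [I [L [intL NL]]]; exists I, L; split=> //.
exact: isomorphic_trans MN NL.
Qed.

Lemma interval_decomposable_sum (I : choiceType) (M : I -> pmod k P) :
  (forall i, interval_decomposable (M i)) ->
  interval_decomposable (pmod_sum M).
Proof.
move=> /dfun_choice[J] /dfun_choice[N] JN.
exists {i : I & J i}, (fun ij => N (tag ij) (tagged ij)); split.
  by move=> [i j]; exact: (JN i).1.
apply: isomorphic_trans (pmod_sum_sum N).
by apply: pmod_sum_isomorphic => i; exact: (JN i).2.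
Qed.

End CoproductIsomorphisms.

(** * Indicator modules *)

Lemma ind_mapK (k : fieldType) (b c : bool) :
  b = c -> cancel (ind_map k b c) (ind_map k c b).
Proof. by move=> -> v; rewrite !ind_map1. Qed.

Lemma indicator_notin (k : fieldType) (d : Order.disp_t) (P : porderType d)
    (S : set P) (convS : poset_convex S) (x : P) (v : indicator k convS x) :
  ~ S x -> v = 0.
Proof.
move=> nSx; have xS : x \in S = false by apply/negP => /set_mem.
by move: v; rewrite /= xS => v; exact: ind_space0.
Qed.

Section IndicatorMorphisms.
Variables (k : fieldType) (d : Order.disp_t) (P : porderType d).

Section Morphism.
Variables (S T : set P) (convS : poset_convex S) (convT : poset_convex T).
Hypothesis ST : forall x y, (x <= y)%O -> S x -> T y -> S y /\ T x.

Lemma indicator_mor_nat (x y : P) (xy : (x <= y)%O)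
    (v : indicator k convS x) :
  ind_map k (y \in S) (y \in T) (pmod_map (indicator k convS) xy v) =
  pmod_map (indicator k convT) xy (ind_map k (x \in S) (x \in T) v).
Proof.
rewrite -[LHS]ind_mapM -1?[RHS]ind_mapM//; apply/implyP => /andP[].
  by move=> /set_mem Sx /set_mem Ty; apply/mem_set; case: (ST xy Sx Ty).
by move=> /set_mem Sx /set_mem Ty; apply/mem_set; case: (ST xy Sx Ty).
Qed.

(** The morphism between indicator modules that is the identity of the field on
    the intersection of the two supports. *)
Definition indicator_mor : pmor (indicator k convS) (indicator k convT) :=
  @PMor k d P (indicator k convS) (indicator k convT)
    (fun x => ind_map k (x \in S) (x \in T)) indicator_mor_nat.

End Morphism.

End IndicatorMorphisms.

Section PullbackIndicator.
Variables (k : fieldType) (d d' : Order.disp_t).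
Variables (R : porderType d') (P : porderType d) (f : {omorphism R -> P}).
Variables (S : set P) (convS : poset_convex S).
Variable (convfS : poset_convex (f @^-1` S)).

(** The identity, regarded as a morphism between two modules that differ only by
    their proofs of functoriality. *)
Definition pullback_indicator :
    pmor (indicator k convfS) (pullback f (indicator k convS)) :=
  @PMor k d' R (indicator k convfS) (pullback f (indicator k convS))
    (fun x => idfun) (fun x y xy v => erefl).

Lemma pullback_indicator_isomorphic :
  @isomorphic (Rep k R) (pullback f (indicator k convS)) (indicator k convfS).
Proof.
apply/isomorphic_sym/(@pmor_bij_isomorphic _ _ _ _ _ pullback_indicator) => x.
by exists id.
Qed.

End PullbackIndicator.

(** * Connected components *)

Section Components.
Variables (d : Order.disp_t) (P : porderType d) (S : set P).

(** [zigzag x y]: some finite sequence of elements of [S], with consecutive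
    elements comparable, leads from [x] to [y]; [x] itself is not required to
    lie in [S]. *)
Definition zigzag (x y : P) : Prop := exists s : seq P,
  [/\ path (fun a b => (a >=< b)%O) x s, last x s = y &
      forall z, z \in s -> S z].

Lemma zigzag_refl x : zigzag x x.
Proof. by exists [::]. Qed.

Lemma zigzag_step x y : S y -> (x >=< y)%O -> zigzag x y.
Proof.
move=> Sy xy; exists [:: y]; split=> //= [|z]; rewrite ?andbT//.
by rewrite inE => /eqP->.
Qed.

Lemma zigzag_trans y x z : zigzag x y -> zigzag y z -> zigzag x z.
Proof.
move=> [s [xs lasts Ss]] [t [yt lastt St]]; exists (s ++ t).
split; first by rewrite cat_path xs lasts yt.
  by rewrite last_cat lasts.
by move=> u; rewrite mem_cat => /orP[/Ss|/St].
Qed.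

Lemma zigzag_sym x y : S x -> zigzag x y -> zigzag y x.
Proof.
move=> Sx [s [xs <- Ss]]; exists (rev (belast x s)); split.
- by rewrite rev_path; apply: sub_path xs => a b /=; rewrite comparable_sym.
- by case: s {xs Ss} => //= z s; rewrite rev_cons last_rcons.
- by move=> z; rewrite mem_rev => /mem_belast; rewrite inE => /orP[/eqP->|/Ss].
Qed.

Lemma zigzag_mem x y : S x -> zigzag x y -> S y.
Proof.
move=> Sx [s [_ <- Ss]]; have := mem_last x s.
by rewrite inE => /orP[/eqP->|/Ss].
Qed.

Lemma path_zigzag x s y :
  path (fun a b => (a >=< b)%O) x s -> (forall z, z \in s -> S z) ->
  y \in s -> zigzag x y.
Proof.
move=> xs Ss /splitPr E; case: E xs Ss => s1 s2.
rewrite -cat_rcons cat_path => /andP[xs1 _] Ss; exists (rcons s1 y).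
by split=> //; [rewrite last_rcons|move=> z zs; apply: Ss; rewrite mem_cat zs].
Qed.

(** The elements of [S] whose connected component in [S] is [C]; this set is
    [C] or empty. *)
Definition component (C : set P) : set P := [set x | S x /\ zigzag x = C].

Lemma zigzag_component C x y : component C x -> zigzag x y -> component C y.
Proof.
move=> [Sx <-] xy; have Sy := zigzag_mem Sx xy; split=> //.
apply/seteqP; split=> z; first exact: zigzag_trans.
by apply: zigzag_trans; exact: zigzag_sym.
Qed.

(** No relation of the order joins two different components. *)
Lemma component_le C x y : S x -> S y -> (x <= y)%O ->
  component C x <-> component C y.
Proof.
move=> Sx Sy xy; split=> /zigzag_component; apply; apply: zigzag_step => //.
  exact: le_comparable.
exact: ge_comparable.
Qed.

Lemma component_interval C : poset_convex S -> poset_interval (component C).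
Proof.
move=> convS; split=> [x y z Cx [Sy _] xz zy|x y Cx [_ yC]].
  have Sz : S z := convS _ _ _ Cx.1 Sy xz zy.
  exact: (component_le C Cx.1 Sz xz).1.
have : zigzag x y by rewrite Cx.2 -yC; exact: zigzag_refl.
move=> [s [xs lasts Ss]]; exists s; split=> // z zs.
by apply: zigzag_component Cx _; exact: path_zigzag zs.
Qed.

End Components.

Section ComponentDecomposition.
Variables (k : fieldType) (d : Order.disp_t) (P : porderType d).
Variables (S : set P) (convS : poset_convex S).

Let N (C : set P) : pmod k P :=
  indicator k (component_interval C convS).1.

Lemma component_le_S (C : set P) (x y : P) :
  (x <= y)%O -> component S C x -> S y -> component S C y /\ S x.
Proof.
by move=> xy Cx Sy; split; [exact: (component_le C Cx.1 Sy xy).1|exact: Cx.1].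
Qed.

Let component_mor C : pmor (N C) (indicator k convS) :=
  indicator_mor k _ convS (@component_le_S C).

(** The decomposition is indexed by all the sets of elements; those that are not
    a component of [S] contribute a zero summand. *)
Lemma indicator_sum_components :
  @isomorphic (Rep k P) (pmod_sum N) (indicator k convS).
Proof.
apply: (@pmor_bij_isomorphic _ _ _ _ _ (pmod_desc component_mor)) => x.
pose C := zigzag S x.
have CS : (x \in S) = (x \in component S C).
  by apply/idP/idP => /set_mem Sx; apply/mem_set; [split|case: Sx].
pose g : {linear indicator k convS x -> pmod_sum N x} :=
  dsum_inj (V := fun D => N D x) C \o ind_map k (x \in S) (x \in component S C).
exists g => v; last by rewrite [LHS]dsum_desc_inj; exact: ind_mapK.
suff : (g \o pmod_desc component_mor x : {linear _ -> _}) =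
       (idfun : {linear pmod_sum N x -> pmod_sum N x}).
  by move=> /(congr1 (fun h : {linear pmod_sum N x -> pmod_sum N x} => h v)).
apply: dsum_ext => D w; rewrite -[LHS]/(g (pmod_desc component_mor x _)).
rewrite [X in g X]dsum_desc_inj -[RHS]/(dsum_inj D w).
have [Dx|nDx] := pselect (component S D x); last first.
  by rewrite (indicator_notin w nDx) !linear0.
move: w; have [_ <-] := Dx => w; congr (dsum_inj _ _).
by apply: ind_mapK; rewrite CS.
Qed.

Lemma indicator_interval_decomposable :
  interval_decomposable (indicator k convS).
Proof.
exists (set P), N; split; last exact/isomorphic_sym/indicator_sum_components.
move=> C; exists (component S C), (component_interval C convS).
exact: isomorphic_refl.
Qed.

End ComponentDecomposition.

(** * Left Kan extensions *)

Section LanTheory.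
Variables (k : fieldType) (d d' : Order.disp_t).
Variables (P : porderType d) (R : porderType d') (f : {omorphism P -> R}).

Lemma pullback_morM (M N L : pmod k R) (g : pmor N L) (h : pmor M N) :
  pullback_mor f (pmor_comp g h) =
  pmor_comp (pullback_mor f g) (pullback_mor f h).
Proof. exact: pmor_ext. Qed.

Lemma lan_unit_ext (M : pmod k P) (N : pmod k R) (g h : pmor (lan_obj f M) N) :
  pmor_comp (pullback_mor f g) (lan_unit f M) =
  pmor_comp (pullback_mor f h) (lan_unit f M) -> g = h.
Proof.
move=> gh; have [u [_ uniq_u]] :=
  lan_universal (pmor_comp (pullback_mor f h) (lan_unit f M)).
by rewrite -(uniq_u g gh) (uniq_u h erefl).
Qed.

Lemma lan_desc_unit (M : pmod k P) (N : pmod k R) (g : pmor M (pullback f N)) :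
  pmor_comp (pullback_mor f (lan_desc g)) (lan_unit f M) = g.
Proof. by apply: pmor_ext => a v; exact: lan_descE. Qed.

Lemma lan_desc_colim_inj (M : pmod k P) (N : pmod k R)
    (g : pmor M (pullback f N)) (x : R) (a : subposet (comma f x))
    (w : M (incl a)) :
  lan_desc g x (colim_inj (restriction M (comma f x)) a w) =
  pmod_map N (subposetP a : (f (incl a) <= x)%O) (g (incl a) w).
Proof. exact: colim_desc_inj. Qed.

(** Left Kan extension commutes with direct sums, as a left adjoint does: both
    composites are identities because they agree on the units. *)
Lemma lan_sum (I : choiceType) (M : I -> pmod k P) :
  @isomorphic (Rep k R) (lan k f (pmod_sum M))
    (pmod_sum (fun i => lan k f (M i) : pmod k R)).
Proof.
pose L i : pmod k R := lan_obj f (M i).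
pose g : pmor (pmod_sum M) (pullback f (pmod_sum L)) :=
  pmod_desc (fun i => pmor_comp (pullback_mor f (pmod_inj L i))
                        (lan_unit f (M i))).
pose h : pmor (pmod_sum L) (lan_obj f (pmod_sum M)) :=
  pmod_desc (fun i => lan_mor f (pmod_inj M i)).
exists (lan_desc g), h; split.
  apply: lan_unit_ext; rewrite /= pullback_morM -pmor_compA lan_desc_unit.
  apply: pmod_sum_ext => i; rewrite -pmor_compA pmod_desc_inj pmor_compA.
  rewrite -pullback_morM pmod_desc_inj lan_unit_mor.
  exact: pmor_ext.
apply: pmod_sum_ext => i; rewrite /= -pmor_compA pmod_desc_inj pmor_comp1m.
apply: lan_unit_ext; rewrite pullback_morM -pmor_compA lan_unit_mor.
by rewrite pmor_compA lan_desc_unit pmod_desc_inj.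
Qed.

End LanTheory.

(** * Induction along an interior system *)

Section Induction.
Variables (k : fieldType) (d : Order.disp_t) (P : porderType d).
Variables (Q : set P) (intQ : interior_system Q).

Lemma incl_qfloor_le (a : P) : (incl (qfloor intQ a) <= a)%O.
Proof. by case: (qfloorP intQ a). Qed.

Lemma le_qfloor_incl (y : subposet Q) : (y <= qfloor intQ (incl y))%O.
Proof.
by have [_ _] := qfloorP intQ (incl y); apply=> //; exact: subposetP.
Qed.

Lemma qfloor_incl (y : subposet Q) : qfloor intQ (incl y) = y.
Proof.
by apply/le_anti; rewrite le_qfloor_incl andbT; exact: incl_qfloor_le.
Qed.

Section Object.
Variable M : pmod k (subposet Q).

Let to_Ind_at (a : P) :
    {linear pullback (qfloor intQ) M a -> lan_obj (@incl d P Q) M a} :=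
  pmod_map (lan_obj (@incl d P Q) M) (incl_qfloor_le a) \o
    lan_unit (@incl d P Q) M (qfloor intQ a).

Lemma to_Ind_nat (a b : P) (ab : (a <= b)%O)
    (v : pullback (qfloor intQ) M a) :
  to_Ind_at b (pmod_map (pullback (qfloor intQ) M) ab v) =
  pmod_map (lan_obj (@incl d P Q) M) ab (to_Ind_at a v).
Proof.
pose L := lan_obj (@incl d P Q) M.
rewrite -[LHS]/(pmod_map L _ (lan_unit _ M _ (pmod_map M _ v))) pmor_nat.
rewrite -[RHS]/(pmod_map L _ (pmod_map L _ _)).
have ab' : (incl (qfloor intQ a) <= b)%O := le_trans (incl_qfloor_le a) ab.
by rewrite -!(@pmod_mapM k d P L _ _ _ _ _ ab').
Qed.

(** The comparison of the pointwise formula [M (qfloor a)] with the left Kan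
    extension: the colimit over the elements of [Q] below [a] is attained at
    the largest of them. *)
Definition to_Ind :
    pmor (pullback (qfloor intQ) M) (lan_obj (@incl d P Q) M) :=
  PMor to_Ind_nat.

Let unit_at (y : subposet Q) :
    {linear M y -> pullback (@incl d P Q) (pullback (qfloor intQ) M) y} :=
  pmod_map M (le_qfloor_incl y).

Lemma of_Ind_subproof (x y : subposet Q) (xy : (x <= y)%O) (v : M x) :
  unit_at y (pmod_map M xy v) =
  pmod_map (pullback (@incl d P Q) (pullback (qfloor intQ) M)) xy (unit_at x v).
Proof.
have xy' : (x <= qfloor intQ (incl y))%O := le_trans xy (le_qfloor_incl y).
rewrite -[LHS](@pmod_mapM k d _ M _ _ _ _ _ xy').
exact: (@pmod_mapM k d _ M _ _ _ _ _ xy').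
Qed.

(** The inverse of [to_Ind], induced by the structure maps of [M] from each [y]
    in [Q] to its floor, which is [y] itself. *)
Definition of_Ind :
    pmor (lan_obj (@incl d P Q) M) (pullback (qfloor intQ) M) :=
  lan_desc (PMor of_Ind_subproof).

Lemma to_IndK : pmor_comp of_Ind to_Ind = pmor_id _.
Proof.
apply: pmor_ext => a v.
rewrite -[LHS]/(of_Ind a (pmod_map (lan_obj (@incl d P Q) M)
  (incl_qfloor_le a) (lan_unit (@incl d P Q) M (qfloor intQ a) v))).
rewrite pmor_nat lan_descE.
rewrite -[LHS](@pmod_mapM k d _ M _ _ _ _ _ (lexx _)).
exact: (@pmod_map1 k d _ M _ _ v).
Qed.

Lemma of_IndK : pmor_comp to_Ind of_Ind = pmor_id _.
Proof.
apply: lan_unit_ext; apply: pmor_ext => y v.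
rewrite -[LHS]/(to_Ind (incl y)
  (of_Ind (incl y) (lan_unit (@incl d P Q) M y v))).
rewrite -[RHS]/(lan_unit (@incl d P Q) M y v) lan_descE.
pose L := lan_obj (@incl d P Q) M.
rewrite -[LHS]/(pmod_map L _ (lan_unit _ M _ (pmod_map M _ v))) pmor_nat.
rewrite -[LHS](@pmod_mapM k d _ L _ _ _ _ _ (lexx _)).
exact: (@pmod_map1 k d _ L).
Qed.

Lemma Ind_pullback :
  @isomorphic (Rep k P) (Ind k Q M) (pullback (qfloor intQ) M).
Proof. by exists of_Ind, to_Ind; split; [exact: of_IndK|exact: to_IndK]. Qed.

End Object.

Lemma to_Ind_mor (M N : pmod k (subposet Q)) (u : pmor M N) :
  pmor_comp (lan_mor (@incl d P Q) u) (to_Ind M) =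
  pmor_comp (to_Ind N) (pullback_mor (qfloor intQ) u).
Proof.
apply: pmor_ext => a v.
rewrite -[LHS]/(lan_mor (@incl d P Q) u a (pmod_map (lan_obj (@incl d P Q) M)
  (incl_qfloor_le a) (lan_unit (@incl d P Q) M (qfloor intQ a) v))) pmor_nat.
by congr (pmod_map _ _ _); exact: lan_morE.
Qed.

Lemma qceil_convex (S : set (subposet Q)) :
  poset_convex S -> poset_convex (qceil intQ S).
Proof.
by move=> convS x y z Sx Sy xz zy; apply: convS Sx Sy _ _; exact: qfloor_homo.
Qed.

(** Two elements of [qceil S] are linked by going down to their floors, which a
    path in [S] connects. *)
Lemma qceil_interval (S : set (subposet Q)) :
  poset_interval S -> poset_interval (qceil intQ S).
Proof.
move=> [convS connS]; split=> [|x y Sx Sy]; first exact: qceil_convex.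
have incS (z : subposet Q) : S z -> qceil intQ S (incl z).
  by rewrite /qceil /= qfloor_incl.
have [s [path_s last_s Ss]] := connS _ _ Sx Sy.
suff : zigzag (qceil intQ S) x y by [].
apply: (@zigzag_trans _ _ _ (incl (qfloor intQ x))).
  by apply: zigzag_step; [exact: incS|exact/ge_comparable/incl_qfloor_le].
apply: (@zigzag_trans _ _ _ (incl (qfloor intQ y))); last first.
  by apply: zigzag_step => //; exact/le_comparable/incl_qfloor_le.
exists [seq incl z | z <- s]; split.
- by rewrite path_map.
- by rewrite last_map last_s.
- by move=> _ /mapP[z /Ss Sz ->]; exact: incS.
Qed.

Lemma Ind_indicator (S : set (subposet Q)) (convS : poset_convex S)
    (convS' : poset_convex (qceil intQ S)) :
  @isomorphic (Rep k P) (Ind k Q (indicator k convS)) (indicator k convS').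
Proof.
apply: isomorphic_trans (Ind_pullback _) _.
exact: (pullback_indicator_isomorphic k convS convS').
Qed.

Lemma Ind_interval_module (M : Rep k (subposet Q)) :
  interval_module M -> interval_module (Ind k Q M).
Proof.
move=> [S [intS MS]]; exists (qceil intQ S), (qceil_interval intS).
apply: isomorphic_trans (functor_isomorphic (Ind k Q) MS) _.
exact: Ind_indicator.
Qed.

Lemma Ind_interval_decomposable (M : Rep k (subposet Q)) :
  interval_decomposable M -> interval_decomposable (Ind k Q M).
Proof.
move=> [I [N [intN MN]]]; exists I, (fun i => Ind k Q (N i)); split.
  by move=> i; exact: Ind_interval_module.
apply: isomorphic_trans (functor_isomorphic (Ind k Q) MN) _.
exact: lan_sum.
Qed.

End Induction.

(** * The adjunction *)

Section Adjunction.
Variables (k : fieldType) (d : Order.disp_t) (P : porderType d).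
Variables (Q : set P) (intQ : interior_system Q).

(* As [Ind N] is the pullback of [N] along the floor map, the transpose of [u] is
   the pullback of [u] precomposed with the unit of the left Kan extension. *)
Let transpose (M : Rep k P) (N : Rep k (subposet Q))
    (u : mor (Cont k intQ M) N) : mor M (Ind k Q N) :=
  pmor_comp (to_Ind intQ N)
    (pmor_comp (pullback_mor (qfloor intQ) u) (lan_unit (qfloor intQ) M)).

Lemma transpose_bij M N : bijective (@transpose M N).
Proof.
exists (fun g => lan_desc (pmor_comp (of_Ind intQ N) g)) => [u|g].
  apply: lan_unit_ext; rewrite lan_desc_unit /transpose pmor_compA to_IndK.
  by rewrite pmor_comp1m.
by rewrite /transpose lan_desc_unit pmor_compA of_IndK pmor_comp1m.
Qed.

Lemma Cont_Ind_adjunction : adjunction (Cont k intQ) (Ind k Q).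
Proof.
apply: (Adjunction transpose_bij) => [M M' N u f|M N N' v f].
  rewrite /= /transpose pullback_morM -!pmor_compA.
  by rewrite (lan_unit_mor (qfloor intQ) u).
rewrite /= /transpose pullback_morM !pmor_compA.
by rewrite (to_Ind_mor intQ v).
Qed.

End Adjunction.

Section RestrictAdjunction.
Variables (C D : category) (A : C -> Prop) (B : D -> Prop).
Variables (F : functor C D) (G : functor D C).
Hypotheses (FAB : forall X, A X -> B (F X)) (GBA : forall Y, B Y -> A (G Y)).

(** An adjunction restricts to full subcategories preserved by both functors,
    with the same bijections on morphisms. *)
Definition restrict_adjunction (a : adjunction F G) :
    adjunction (restrict_functor FAB) (restrict_functor GBA) :=
  @Adjunction (full_subcategory A) (full_subcategory B)
    (restrict_functor FAB) (restrict_functor GBA)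
    (fun X Y f => adj a f) (fun X Y => adj_bij a (sval X) (sval Y))
    (fun X X' Y u f => adj_natl a u f) (fun X Y Y' v f => adj_natr a v f).

End RestrictAdjunction.

(** * Contraction of interval modules *)

Section Closure.
Variables (d : Order.disp_t) (P : porderType d).
Variables (Q : set P) (intQ : interior_system Q).
Hypothesis alQ : aligned intQ.
Variables (T : set P) (convT : poset_convex T).

(* The poset that indexes the colimit computing [Cont] at [x]. *)
Let D (x : subposet Q) : set P := [set a | (qfloor intQ a <= x)%O].

(** Since [D x] is filtered, any of its elements has an upper bound in the fiber
    over [x], and a convex [T] that contains all the elements of [D x] above one
    of them meets [D x] in an upset. *)
Lemma qclosure_tail (x : subposet Q) :
  qclosure intQ T x <->
  exists2 a, D x a & forall e, D x e -> (a <= e)%O -> T e.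
Proof.
split=> [[[t [Tt tx]] [_ upT]]|[a Dxa aT]].
  exists t => [|e Dxe te]; first by rewrite /D /= tx.
  suff ex : qfloor intQ e = x by case: (upT t e).
  by apply/le_anti; rewrite [X in X && _]Dxe -[X in (X <= _)%O]tx qfloor_homo.
have fiber_ge e b : qfiber intQ x b -> D x e -> (b <= e)%O -> qfiber intQ x e.
  by move=> bx Dxe be; apply/le_anti; rewrite [X in X && _]Dxe -bx qfloor_homo.
have xx : qfiber intQ x (incl x) := qfloor_incl intQ x.
have fiberD e : qfiber intQ x e -> D x e by rewrite /D /= => ->.
split.
  have [c [Dxc ac xc]] := alQ Dxa (fiberD _ xx).
  by exists c; split; [exact: aT|exact: fiber_ge xc].
split=> [u [_ ux] //|u v [Tu ux] vx uv]; split=> //.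
have [c [Dxc vc ac]] := alQ (fiberD _ vx) Dxa.
exact: convT Tu (aT c Dxc ac) uv vc.
Qed.

Lemma qclosure_upset (x : subposet Q) (a e : P) :
  qclosure intQ T x -> T a -> D x e -> (a <= e)%O -> T e.
Proof.
move=> /qclosure_tail[b Dxb bT] Ta Dxe ae.
have [c [Dxc ec bc]] := alQ Dxe Dxb.
exact: convT Ta (bT c Dxc bc) ae ec.
Qed.

Lemma qclosure_down (x y : subposet Q) (a : P) :
  (x <= y)%O -> D x a -> T a -> qclosure intQ T y -> qclosure intQ T x.
Proof.
move=> xy Dxa Ta yT; apply/qclosure_tail; exists a => // e Dxe ae.
by apply: (qclosure_upset yT Ta) ae; exact: le_trans xy.
Qed.

Lemma qclosure_convex : poset_convex (qclosure intQ T).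
Proof.
move=> x y z [[a [Ta ax]] _] yT xz zy; apply: qclosure_down zy _ Ta yT.
by rewrite /D /= ax.
Qed.

(** If [x] is outside the closure, one can leave [T] by going up from any element
    of [D x]. *)
Lemma not_qclosure (x : subposet Q) (a : P) :
  ~ qclosure intQ T x -> D x a -> exists e, [/\ D x e, (a <= e)%O & ~ T e].
Proof.
move=> nxT Dxa; apply: contrapT => nE; apply: nxT; apply/qclosure_tail.
by exists a => // e Dxe ae; apply: contrapT => nTe; apply: nE; exists e.
Qed.

End Closure.

Section Contraction.
Variables (k : fieldType) (d : Order.disp_t) (P : porderType d).
Variables (Q : set P) (intQ : interior_system Q).
Hypothesis alQ : aligned intQ.

Section Indicator.
Variables (T : set P) (convT : poset_convex T).
Variable convT' : poset_convex (qclosure intQ T).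

Lemma qclosure_restrict (a b : P) : (a <= b)%O -> T a ->
  qceil intQ (qclosure intQ T) b -> T b /\ qceil intQ (qclosure intQ T) a.
Proof.
move=> ab Ta bT; split.
  by apply: (qclosure_upset alQ convT bT Ta) ab; exact: lexx.
apply: (qclosure_down alQ convT _ _ Ta bT); last exact: lexx.
exact: qfloor_homo.
Qed.

(* The transpose of the comparison [u] below: the identity of the field at the
   elements of [T] whose floor is in the closure, and zero elsewhere. *)
Let unit_mor :
    pmor (indicator k convT)
      (pullback (qfloor intQ) (indicator k convT')) :=
  pmor_comp (pullback_indicator k convT' (qceil_convex convT'))
    (indicator_mor k convT (qceil_convex convT') qclosure_restrict).

Let u : pmor (lan_obj (qfloor intQ) (indicator k convT)) (indicator k convT') :=
  lan_desc unit_mor.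

(* The colimit leg at an element [a] whose floor is at most [x]. *)
Let cinj (x : subposet Q) (a : P) (ax : comma (qfloor intQ) x a) :
    {linear indicator k convT a ->
       lan_obj (qfloor intQ) (indicator k convT) x} :=
  colim_inj (restriction (indicator k convT) (comma (qfloor intQ) x))
    (insubposet ax).

Let cinj_le x a b (ax : comma (qfloor intQ) x a) (bx : comma (qfloor intQ) x b)
    (v : indicator k convT a) : (a <= b)%O ->
  cinj ax v = cinj bx (ind_map k (a \in T) (b \in T) v).
Proof.
move=> ab; have ab' : (insubposet ax <= insubposet bx)%O := ab.
pose M := restriction (indicator k convT) (comma (qfloor intQ) x).
exact: (esym (@colim_injE k _ _ M _ _ ab' v)).
Qed.

(** If [x] is in the closure, a point [t] of [T] in the fiber over [x] yields
    the inverse: every element of the colimit comes from [t], by passing to a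
    common upper bound. Otherwise the colimit vanishes. *)
Lemma Cont_indicator_bij x : bijective (u x).
Proof.
pose L := lan_obj (qfloor intQ) (indicator k convT) x.
have u_cinj a (ax : comma (qfloor intQ) x a) v :
    u x (cinj ax v) = ind_map k (a \in T) (x \in qclosure intQ T) v.
  have aT : (a \in T) && (x \in qclosure intQ T) ==>
      (qfloor intQ a \in qclosure intQ T).
    apply/implyP => /andP[/set_mem Ta /set_mem xT].
    by apply/mem_set; apply: (qclosure_down alQ convT ax _ Ta xT); exact: lexx.
  rewrite [LHS]lan_desc_colim_inj; exact: (esym (ind_mapM v aT)).
have cinj_ext (h : {linear L -> L}) :
    (forall a (ax : comma (qfloor intQ) x a) v, h (cinj ax v) = cinj ax v) ->
    forall v, h v = v.
  move=> hE v; suff -> : h = (idfun : {linear L -> L}) by [].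
  apply: colim_ext => -[a ax] w.
  rewrite (_ : ax = mem_set (set_mem ax)); last exact: Prop_irrelevance.
  exact: hE.
have [xT|nxT] := pselect (qclosure intQ T x); last first.
  have L0 (v : L) : v = 0.
    apply/esym/(cinj_ext \0) => a ax w.
    have [e [ex ae nTe]] := not_qclosure alQ convT nxT ax.
    rewrite (cinj_le ax ex w ae).
    pose w' : indicator k convT e := ind_map k (a \in T) (e \in T) w.
    by rewrite -[ind_map _ _ _ _]/w' (indicator_notin w' nTe) linear0.
  exists (\0 : {linear indicator k convT' x -> L}) => v; first exact/esym/L0.
  by rewrite linear0 (indicator_notin v nxT).
have [[t [Tt tfx]] _] := xT.
have tx : comma (qfloor intQ) x t by rewrite /comma /= tfx.
pose g : {linear indicator k convT' x -> L} :=
  cinj tx \o ind_map k (x \in qclosure intQ T) (t \in T).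
have tT : (x \in qclosure intQ T) = (t \in T) by rewrite !mem_set.
exists g => v; last first.
  pose w : indicator k convT t := ind_map k (x \in qclosure intQ T) (t \in T) v.
  by rewrite -[LHS]/(u x (cinj tx w)) u_cinj; exact: ind_mapK.
suff E : forall v, (g \o u x : {linear L -> L}) v = v by exact: (E v).
apply: cinj_ext => a ax w; rewrite -[LHS]/(g (u x (cinj ax w))) u_cinj.
have [c [cx ac tc]] := alQ ax tx.
pose v' : indicator k convT t := ind_map k (x \in qclosure intQ T) (t \in T)
  (ind_map k (a \in T) (x \in qclosure intQ T) w).
rewrite -[LHS]/(cinj tx v') (cinj_le tx cx v' tc) (cinj_le ax cx w ac).
by rewrite /v' -!ind_mapM// ?(mem_set xT) ?(mem_set Tt) ?implybT.
Qed.

Lemma Cont_indicator :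
  @isomorphic (Rep k (subposet Q)) (Cont k intQ (indicator k convT))
    (indicator k convT').
Proof. exact: pmor_bij_isomorphic Cont_indicator_bij. Qed.

End Indicator.

Lemma Cont_interval_module (M : Rep k P) :
  interval_module M -> interval_decomposable (Cont k intQ M).
Proof.
move=> [T [intT MT]]; set convT := proj1 intT in MT.
apply: interval_decomposable_iso (functor_isomorphic (Cont k intQ) MT) _.
apply: interval_decomposable_iso
  (Cont_indicator convT (qclosure_convex alQ convT)) _.
exact: indicator_interval_decomposable.
Qed.

Lemma Cont_interval_decomposable (M : Rep k P) :
  interval_decomposable M -> interval_decomposable (Cont k intQ M).
Proof.
move=> [I [N [intN MN]]].
apply: interval_decomposable_iso (functor_isomorphic (Cont k intQ) MN) _.
apply: interval_decomposable_iso (lan_sum (qfloor intQ) N) _.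
by apply: interval_decomposable_sum => i; exact: Cont_interval_module.
Qed.

End Contraction.

(** * The restricted adjoint pair *)

Theorem proposition4p4 (k : fieldType) (d : Order.disp_t) (P : porderType d)
    (Q : set P) (intQ : interior_system Q) :
  ((forall M : Rep k (subposet Q),
      interval_module M -> interval_module (Ind k Q M)) /\
   (forall (S : set (subposet Q)) (intS : poset_interval S),
      exists intS' : poset_interval (qceil intQ S),
        @isomorphic (Rep k P)
          (Ind k Q (indicator k (proj1 intS))) (indicator k (proj1 intS'))))
  /\
  (aligned intQ ->
    (forall M : Rep k P,
       interval_module M -> interval_decomposable (Cont k intQ M)) /\
    (forall (T : set P) (intT : poset_interval T),
       exists convT' : poset_convex (qclosure intQ T),
         @isomorphic (Rep k (subposet Q))
           (Cont k intQ (indicator k (proj1 intT))) (indicator k convT')))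
  /\
  (aligned intQ ->
    inhabited (adjunction (Cont k intQ) (Ind k Q)) /\
    exists (ContID : forall M : Rep k P,
              interval_decomposable M -> interval_decomposable (Cont k intQ M))
           (IndID : forall N : Rep k (subposet Q),
              interval_decomposable N -> interval_decomposable (Ind k Q N)),
      forall A : adjunction (Cont k intQ) (Ind k Q),
      exists B : adjunction (restrict_functor ContID) (restrict_functor IndID),
        forall (M : full_subcategory (@interval_decomposable k d P))
               (N : full_subcategory (@interval_decomposable k d (subposet Q)))
               (f : mor (Cont k intQ (sval M)) (sval N)),
          @adj _ _ _ _ B M N f = adj A f).
Proof.
split; [split | split=> alQ; split].
- exact: Ind_interval_module.
- move=> S intS; exists (qceil_interval intQ intS); exact: Ind_indicator.
- exact: Cont_interval_module.
- move=> T intT; exists (qclosure_convex alQ (proj1 intT)).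
  exact: Cont_indicator.
- by split; exact: Cont_Ind_adjunction.
- exists (@Cont_interval_decomposable k d P Q intQ alQ).
  exists (@Ind_interval_decomposable k d P Q intQ) => A.
  by exists (restrict_adjunction _ _ A).
Qed.
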